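(* Let $A$ be any set. For every $Q\subseteq\mathrm{Rp}_A$ we have $$\mathrm{Invp}\,\mathrm{Polp}\,Q=\mathrm{LOC}\,[Q]_{\mathrm{Rp}}.$$
   Context: $A$ is an arbitrary set (possibly empty, finite or infinite). $\mathbb N=\{0,1,2,\dots\}$, $n=\{0,\dots,n-1\}$ for $n\in\mathbb N$, and $A^n$ is the set of maps $n\to A$ (so $A^0=\{\emptyset\}$). $O_A^{(n)}=A^{A^n}$ is the set of $n$-ary operations, and $O_A=\biguplus_{n\in\mathbb N}O_A^{(n)}$ (nullary operations included). An $m$-ary relation pair ($m\in\mathbb N$) is a pair $(\rho,\rho')$ with $\rho'\subseteq\rho\subseteq A^m$; $\mathrm{Rp}_A^{(m)}$ is the set of these, and $\mathrm{Rp}_A=\biguplus_{m\in\mathbb N}\mathrm{Rp}_A^{(m)}$ (disjoint union over arities); $Q^{(m)}=Q\cap\mathrm{Rp}_A^{(m)}$ for $Q\subseteq\mathrm{Rp}_A$. An operation $f\in O_A^{(n)}$ preserves $(\rho,\rho')\in \mathrm{Rp}_A^{(m)}$ if for all $r_0,\dots,r_{n-1}\in\rho$ the $m$-tuple $\big(f(r_0(i),\dots,r_{n-1}(i))\big)_{i<m}$ belongs to $\rho'$. For $F\subseteq O_A$, $\mathrm{Invp}F$ is the set of all pairs in $\mathrm{Rp}_A$ preserved by every $f\in F$. For $Q\subseteq\mathrm{Rp}_A$, $\mathrm{Polp}\,Q$ is the set of all $f\in O_A$ preserving every pair in $Q$. General superposition: given arbitrary sets $I$ and $\mu$, numbers $m,m_i\in\mathbb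 N$ ($i\in I$), maps $\alpha_i:m_i\to\mu$ ($i\in I$) and $\beta:m\to\mu$, and relations $\rho_i\subseteq A^{m_i}$, put $\bigwedge^{\beta}_{(\alpha_i)_{i\in I}}(\rho_i)_{i\in I}=\{a\circ\beta : a\in A^\mu,\ \forall i\in I:\ a\circ\alpha_i\in\rho_i\}\subseteq A^m$. For relation pairs it is applied in both components: $\bigwedge^{\beta}_{(\alpha_i)}(\rho_i,\rho_i')_{i\in I}=\big(\bigwedge^{\beta}_{(\alpha_i)}(\rho_i)_{i\in I},\bigwedge^{\beta}_{(\alpha_i)}(\rho_i')_{i\in I}\big)$. A set $Q\subseteq\mathrm{Rp}_A$ is a relation pair clone if for all such data with $(\rho_i,\rho'_i)\in Q^{(m_i)}$ ($i\in I$) we have $\bigwedge^{\beta}_{(\alpha_i)}(\rho_i,\rho_i')_{i\in I}\in Q^{(m)}$. $[Q]_{\mathrm{Rp}}$ is the least relation pair clone containing $Q$. For $s\in\mathbb N$, $s\text{-}\mathrm{LOC}\,Q=\biguplus_{m\in\mathbb N}\{(\sigma,\sigma')\in\mathrm{Rp}_A^{(m)} : \forall B\subseteq\sigma\text{ with }|B|\le s\ \exists(\rho,\rho')\in Q^{(m)}:\ B\subseteq\rho\text{ and }\rho'\subseteq\sigma'\}$, and $\mathrm{LOC}\,Q=\bigcap_{s\in\mathbb N}s\text{-}\mathrm{LOC}\,Q$. *)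

(* Defs.v *)
From mathcomp Require Import all_boot.
From mathcomp Require Import boolp classical_sets cardinality.

Set Implicit Arguments.
Unset Strict Implicit.
Unset Printing Implicit Defensive.

Local Open Scope classical_set_scope.
Local Open Scope card_scope.

(* [A^n] is the type of maps ['I_n -> A]; disjoint unions over arities are      *)
(* sigma types, so that e.g. the empty pairs of different arities differ.      *)

Definition operation (A : Type) (n : nat) : Type := ('I_n -> A) -> A.

Definition operations (A : Type) : Type := {n : nat & operation A n}.

Record rpair (A : Type) (m : nat) : Type := RPair {
  outer : set ('I_m -> A);
  inner : set ('I_m -> A);
  inner_sub : inner `<=` outer }.

Definition rpairs (A : Type) : Type := {m : nat & rpair A m}.

Definition arity_part (A : Type) (Q : set (rpairs A)) (m : nat) :
    set (rpair A m) :=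
  [set p | Q (existT (rpair A) m p)].
Arguments arity_part {A} Q m _.

Definition preserves (A : Type) (n m : nat) (f : operation A n)
    (p : rpair A m) : Prop :=
  forall r : 'I_n -> ('I_m -> A),
    (forall j, outer p (r j)) -> inner p (fun i => f (fun j => r j i)).

Definition Invp (A : Type) (F : set (operations A)) : set (rpairs A) :=
  [set p | forall f, F f -> preserves (projT2 f) (projT2 p)].

Definition Polp (A : Type) (Q : set (rpairs A)) : set (operations A) :=
  [set f | forall p, Q p -> preserves (projT2 f) (projT2 p)].

Definition superposition (A I mu : Type) (m : nat) (mi : I -> nat)
    (beta : 'I_m -> mu) (alpha : forall i, 'I_(mi i) -> mu)
    (rho : forall i, set ('I_(mi i) -> A)) : set ('I_m -> A) :=
  [set a \o beta | a in [set a : mu -> A | forall i, rho i (a \o alpha i)]].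

Lemma superpositionS (A I mu : Type) (m : nat) (mi : I -> nat)
    (beta : 'I_m -> mu) (alpha : forall i, 'I_(mi i) -> mu)
    (rho rho' : forall i, set ('I_(mi i) -> A)) :
  (forall i, rho' i `<=` rho i) ->
  superposition beta alpha rho' `<=` superposition beta alpha rho.
Proof.
by move=> sub _ [a a_rho' <-]; exists a => // i; apply/sub/a_rho'.
Qed.

Definition rp_superposition (A I mu : Type) (m : nat) (mi : I -> nat)
    (beta : 'I_m -> mu) (alpha : forall i, 'I_(mi i) -> mu)
    (p : forall i, rpair A (mi i)) : rpair A m :=
  @RPair A m
    (superposition beta alpha (fun i => outer (p i)))
    (superposition beta alpha (fun i => inner (p i)))
    (superpositionS (fun i => @inner_sub A (mi i) (p i))).

Definition rp_clone (A : Type) (Q : set (rpairs A)) : Prop :=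
  forall (I mu : Type) (m : nat) (mi : I -> nat)
    (beta : 'I_m -> mu) (alpha : forall i, 'I_(mi i) -> mu)
    (p : forall i, rpair A (mi i)),
    (forall i, arity_part Q (mi i) (p i)) ->
    arity_part Q m (rp_superposition beta alpha p).

Definition rp_clone_generated (A : Type) (Q : set (rpairs A)) :
    set (rpairs A) :=
  smallest (@rp_clone A) Q.

Lemma rp_clone_generatedP (A : Type) (Q : set (rpairs A)) :
  rp_clone (rp_clone_generated Q).
Proof.
move=> I mu m mi beta alpha p pQ C [Cclone QC].
apply: (Cclone) => i; exact: (pQ i C (conj Cclone QC)).
Qed.

Definition sLOC (A : Type) (s : nat) (Q : set (rpairs A)) : set (rpairs A) :=
  [set sigma | forall B : set ('I_(projT1 sigma) -> A),
     B `<=` outer (projT2 sigma) -> B #<= `I_s ->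
     exists rho : rpair A (projT1 sigma),
       [/\ arity_part Q (projT1 sigma) rho,
           B `<=` outer rho &
           inner rho `<=` inner (projT2 sigma)]].

Definition LOC (A : Type) (Q : set (rpairs A)) : set (rpairs A) :=
  \bigcap_s sLOC s Q.

(* Main.v *)
Require Import Defs.
From mathcomp Require Import all_boot.
From mathcomp Require Import boolp classical_sets functions cardinality.

(** The sets [Invp F] are relation pair clones, and an [n]-ary operation sees
    only [n] tuples of a relation at a time, so [Invp F] is also closed under
    [LOC]; this gives the inclusion from right to left.  Conversely, given
    finitely many tuples [r_0, ..., r_(n-1)] of [sigma], take the superposition
    over [mu := A^n] of all pairs of [Q], one copy for each choice of [n] tuples
    [x] in the outer relation, with [alpha] and [beta] reading the tuples [x] and
    [r] columnwise.  Its outer relation contains each [r_j], witnessed by the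
    [j]-th projection, and its inner relation is
    [{f(r_0, ..., r_(n-1)) : f in Polp Q}]. *)

Local Open Scope classical_set_scope.
Local Open Scope card_scope.

Lemma finite_set_range_ord (T : Type) (B : set T) :
  finite_set B -> exists n (r : 'I_n -> T), B = range r.
Proof.
move=> /finite_setP[n Bn].
have /card_esym/card_bijP[g [h _ gK]] := card_eq_trans Bn card_II.
exists n, (fun j => val (g (to_setT j))).
apply/seteqP; split=> [b /mem_set Bb | _ [j _ <-]]; last exact: set_valP.
exists (val (h (SigSub Bb))) => //.
by rewrite (_ : to_setT _ = h (SigSub Bb)) ?gK//; apply: val_inj.
Qed.

(** Choose an assignment [a j] witnessing each [r j]; applying [f] to them pointwise gives a witness
    for the image tuple. *)
Lemma preserves_superposition (A I mu : Type) (n m : nat) (mi : I -> nat)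
    (beta : 'I_m -> mu) (alpha : forall i, 'I_(mi i) -> mu)
    (p : forall i, rpair A (mi i)) (f : operation A n) :
  (forall i, preserves f (p i)) ->
  preserves f (rp_superposition beta alpha p).
Proof.
move=> fp r /= r_outer.
have /choice[a ar] : forall j, exists a : mu -> A,
    (forall i, outer (p i) (a \o alpha i)) /\ a \o beta = r j.
  by move=> j; have [a] := r_outer j; exists a.
exists (fun x => f (fun j => a j x)).
  by move=> i; apply: (fp i (fun j => a j \o alpha i)) => j; have [] := ar j.
apply/funext => i /=; congr f; apply/funext => j.
by have [_ <-] := ar j.
Qed.

Lemma rp_clone_Invp (A : Type) (F : set (operations A)) : rp_clone (Invp F).
Proof.
move=> I mu m mi beta alpha p Fp f Ff.
by apply: preserves_superposition => i; apply: Fp.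
Qed.

Lemma LOC_Invp (A : Type) (F : set (operations A)) : LOC (Invp F) `<=` Invp F.
Proof.
move=> [m sigma] /= sigmaL [n f] /= Ff r r_sigma.
(* The bound [s] in [LOC] is taken to be the arity [n] of [f]. *)
have r_small : range r #<= `I_n.
  rewrite (card_le_trans (card_image_le _ _))//.
  by have /card_eqPle[] := @card_II n.
have [|rho [/= rhoF r_rho rho_sigma]] := sigmaL n I (range r) _ r_small.
  by move=> _ [j _ <-].
by apply/rho_sigma/(rhoF _ Ff) => j; apply: r_rho; exists j.
Qed.

Lemma LOCS (A : Type) (Q Q' : set (rpairs A)) : Q `<=` Q' -> LOC Q `<=` LOC Q'.
Proof.
move=> QQ' sigma sigmaL s _ B Bsigma Bs.
have [rho [Qrho Brho rho_sigma]] := sigmaL s I B Bsigma Bs.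
by exists rho; split=> //; apply: QQ'.
Qed.

Lemma clone_pair_of_tuples (A : Type) (Q : set (rpairs A)) (n m : nat)
    (r : 'I_n -> 'I_m -> A) :
  exists rho : rpair A m,
    [/\ arity_part (rp_clone_generated Q) m rho,
        forall j, outer rho (r j) &
        forall t, inner rho t -> exists f : operation A n,
          Polp Q (existT _ n f) /\ t = (fun i => f (fun j => r j i))].
Proof.
pose I := {p : rpairs A & {x : 'I_n -> 'I_(projT1 p) -> A |
             Q p /\ forall j, outer (projT2 p) (x j)}}.
pose x (i : I) := sval (projT2 i).
pose beta (k : 'I_m) := fun j => r j k.
pose alpha (i : I) k := fun j => x i j k.
exists (rp_superposition beta alpha (fun i : I => projT2 (projT1 i))); split.
- apply: rp_clone_generatedP; case=> [[k p] [y [Qp y_outer]]].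
  exact: sub_gen_smallest Qp.
- move=> j; exists (fun c => c j) => //= -[p [y [Qp y_outer]]].
  exact: y_outer.
(* As [mu] is ['I_n -> A], an assignment is itself an [n]-ary operation, and its inner constraints
   over all of [I] say that it preserves every pair of [Q]. *)
- move=> _ [f f_inner <-]; exists f; split=> // p Qp y y_outer.
  exact: (f_inner (existT _ p (exist _ y (conj Qp y_outer)))).
Qed.

Theorem corollary5p14 (A : Type) (Q : set (rpairs A)) :
  Invp (Polp Q) = LOC (rp_clone_generated Q).
Proof.
apply/seteqP; split=> [[m sigma] /= sigmaI s _ B /= Bsigma Bs|].
- have [|n [r Br]] := @finite_set_range_ord _ B.
    by apply/finite_set_leP; exists s.
  have [rho [rhoQ r_rho rho_f]] := clone_pair_of_tuples A Q n m r.
  exists rho; split=> // [|t /rho_f[f [fQ ->]]].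
    by rewrite Br => _ [j _ <-].
  by apply: (sigmaI _ fQ) => j; apply: Bsigma; rewrite Br; exists j.
- apply: subset_trans _ (@LOC_Invp _ _); apply: LOCS.
  apply: smallest_sub; first exact: rp_clone_Invp.
  by move=> p Qp f; apply.
Qed.
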